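(* Suppose $G$ is a normalized quaternionic Hadamard matrix of order $n$ with at least one non-real entry. Then there are uncountably many normalized quaternionic Hadamard matrices of order $n$ that are equivalent to $G$.
   Context: $\mathbb H$ denotes the real quaternions. A quaternionic Hadamard matrix (QHM) of order $n$ is an $n\times n$ matrix $G$ whose entries are quaternions of norm $1$ and which satisfies $GG^*=nI_n$, where $G^*$ is the conjugate transpose. A QHM is normalized if all entries in its first row and first column equal $1$. Two QHMs are equivalent if one can be obtained from the other by a sequence of operations of the following kinds: multiplying a row on the left by a unit quaternion, multiplying a column on the right by a unit quaternion, interchanging rows, interchanging columns. *)

(* Defs.v *)
From HB Require Import structures.
From mathcomp Require Import all_boot all_order all_algebra.
From mathcomp Require Import ring.
From mathcomp Require Import boolp classical_sets cardinality reals.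

Set Implicit Arguments.
Unset Strict Implicit.
Unset Printing Implicit Defensive.

Import Order.TTheory GRing.Theory Num.Theory.
Local Open Scope ring_scope.

(* [Quat a b c d] is a + b i + c j + d k. *)
Record quat (R : realType) :=
  Quat { quat_re : R; quat_i : R; quat_j : R; quat_k : R }.

Definition quat_tuple (R : realType) (q : quat R) : R * R * R * R :=
  (quat_re q, quat_i q, quat_j q, quat_k q).

Definition tuple_quat (R : realType) (t : R * R * R * R) : quat R :=
  let: (a, b, c, d) := t in Quat a b c d.

Lemma quat_tupleK (R : realType) : cancel (@quat_tuple R) (@tuple_quat R).
Proof. by case. Qed.

HB.instance Definition _ (R : realType) :=
  Choice.copy (quat R) (can_type (@quat_tupleK R)).

Definition quat_zero (R : realType) : quat R := Quat 0 0 0 0.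

Definition quat_one (R : realType) : quat R := Quat 1 0 0 0.

Definition quat_opp (R : realType) (x : quat R) : quat R :=
  let: Quat a b c d := x in Quat (- a) (- b) (- c) (- d).

Definition quat_add (R : realType) (x y : quat R) : quat R :=
  let: Quat a1 b1 c1 d1 := x in let: Quat a2 b2 c2 d2 := y in
  Quat (a1 + a2) (b1 + b2) (c1 + c2) (d1 + d2).

Definition quat_mul (R : realType) (x y : quat R) : quat R :=
  let: Quat a1 b1 c1 d1 := x in let: Quat a2 b2 c2 d2 := y in
  Quat (a1 * a2 - b1 * b2 - c1 * c2 - d1 * d2)
       (a1 * b2 + b1 * a2 + c1 * d2 - d1 * c2)
       (a1 * c2 - b1 * d2 + c1 * a2 + d1 * b2)
       (a1 * d2 + b1 * c2 - c1 * b2 + d1 * a2).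

Lemma quat_addA (R : realType) : associative (@quat_add R).
Proof. by move=> [????] [????] [????] /=; congr Quat; ring. Qed.

Lemma quat_addC (R : realType) : commutative (@quat_add R).
Proof. by move=> [????] [????] /=; congr Quat; ring. Qed.

Lemma quat_add0 (R : realType) : left_id (quat_zero R) (@quat_add R).
Proof. by move=> [????] /=; congr Quat; ring. Qed.

Lemma quat_addN (R : realType) :
  left_inverse (quat_zero R) (@quat_opp R) (@quat_add R).
Proof. by move=> [????] /=; congr Quat; ring. Qed.

Lemma quat_mulA (R : realType) : associative (@quat_mul R).
Proof. by move=> [????] [????] [????] /=; congr Quat; ring. Qed.

Lemma quat_mul1 (R : realType) : left_id (quat_one R) (@quat_mul R).
Proof. by move=> [????] /=; congr Quat; ring. Qed.

Lemma quat_mulr1 (R : realType) : right_id (quat_one R) (@quat_mul R).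
Proof. by move=> [????] /=; congr Quat; ring. Qed.

Lemma quat_mulDl (R : realType) :
  left_distributive (@quat_mul R) (@quat_add R).
Proof. by move=> [????] [????] [????] /=; congr Quat; ring. Qed.

Lemma quat_mulDr (R : realType) :
  right_distributive (@quat_mul R) (@quat_add R).
Proof. by move=> [????] [????] [????] /=; congr Quat; ring. Qed.

Lemma quat_one_neq0 (R : realType) : quat_one R != quat_zero R.
Proof. by apply/eqP => -[] /eqP; rewrite oner_eq0. Qed.

HB.instance Definition _ (R : realType) := GRing.isZmodule.Build (quat R)
  (@quat_addA R) (@quat_addC R) (@quat_add0 R) (@quat_addN R).

HB.instance Definition _ (R : realType) := GRing.Zmodule_isNzRing.Build (quat R)
  (@quat_mulA R) (@quat_mul1 R) (@quat_mulr1 R)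
  (@quat_mulDl R) (@quat_mulDr R) (@quat_one_neq0 R).

Definition quat_conj (R : realType) (q : quat R) : quat R :=
  let: Quat a b c d := q in Quat a (- b) (- c) (- d).

Definition quat_norm (R : realType) (q : quat R) : R :=
  let: Quat a b c d := q in Num.sqrt (a ^+ 2 + b ^+ 2 + c ^+ 2 + d ^+ 2).

Definition quat_real (R : realType) (q : quat R) : Prop :=
  exists a : R, q = Quat a 0 0 0.

Definition adjmx (R : realType) (n : nat) (G : 'M[quat R]_n) : 'M[quat R]_n :=
  \matrix_(i, j) quat_conj (G j i).

Definition is_qhm (R : realType) (n : nat) (G : 'M[quat R]_n) : Prop :=
  (forall i j, quat_norm (G i j) = 1) /\ G *m adjmx G = n%:R%:M.

Definition normalized (R : realType) (n : nat) (G : 'M[quat R]_n) : Prop :=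
  forall i j : 'I_n, (i : nat) = 0%N \/ (j : nat) = 0%N -> G i j = 1.

Definition lmul_row (R : realType) (n : nat) (i0 : 'I_n) (u : quat R)
    (G : 'M[quat R]_n) : 'M[quat R]_n :=
  \matrix_(i, j) (if i == i0 then u * G i j else G i j).

Definition rmul_col (R : realType) (n : nat) (j0 : 'I_n) (u : quat R)
    (G : 'M[quat R]_n) : 'M[quat R]_n :=
  \matrix_(i, j) (if j == j0 then G i j * u else G i j).

(* Symmetric, since each operation is undone by one of the same kind. *)
Inductive qhm_equiv (R : realType) (n : nat) (G : 'M[quat R]_n) :
    'M[quat R]_n -> Prop :=
| qhm_equiv_refl : qhm_equiv G G
| qhm_equiv_row (H : 'M[quat R]_n) (i : 'I_n) (u : quat R) :
    quat_norm u = 1 -> qhm_equiv G H -> qhm_equiv G (lmul_row i u H)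
| qhm_equiv_col (H : 'M[quat R]_n) (j : 'I_n) (u : quat R) :
    quat_norm u = 1 -> qhm_equiv G H -> qhm_equiv G (rmul_col j u H)
| qhm_equiv_xrow (H : 'M[quat R]_n) (i1 i2 : 'I_n) :
    qhm_equiv G H -> qhm_equiv G (xrow i1 i2 H)
| qhm_equiv_xcol (H : 'M[quat R]_n) (j1 j2 : 'I_n) :
    qhm_equiv G H -> qhm_equiv G (xcol j1 j2 H).

(* Main.v *)
Require Import Defs.
From mathcomp Require Import all_boot all_order all_algebra.
From mathcomp Require Import boolp classical_sets cardinality reals.
From mathcomp Require Import ereal measure lebesgue_measure.
From mathcomp Require Import ring lra.

Set Implicit Arguments.
Unset Strict Implicit.
Unset Printing Implicit Defensive.

Import Order.TTheory GRing.Theory Num.Theory.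
Local Open Scope classical_set_scope.
Local Open Scope ring_scope.

(** For a unit quaternion [u], the matrix [u G u^*] is again a normalized
    quaternionic Hadamard matrix equivalent to [G]. If an entry [q] of [G] is not
    real, then [q] fails to commute with one of the imaginary units [e = i, j].
    With [u_t] the normalization of [1 + t e], an equality
    [u_s q u_s^* = u_t q u_t^*] means that [q] commutes with [u_s^* u_t], whose
    imaginary part is a nonzero multiple of [(t - s) e]; hence [s = t], and
    [t |-> u_t G u_t^*] is an injection of the reals into the set in question. *)

Lemma quat_mulE (R : realType) (x y : quat R) : x * y = quat_mul x y.
Proof. by []. Qed.

Lemma quat_conjM (R : realType) (x y : quat R) :
  quat_conj (x * y) = quat_conj y * quat_conj x.
Proof. by case: x y => [????] [????]; rewrite !quat_mulE /=; congr Quat; ring. Qed.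

Lemma quat_conjK (R : realType) : involutive (@quat_conj R).
Proof. by case=> a b c d /=; rewrite !opprK. Qed.

Lemma quat_norm_conj (R : realType) (u : quat R) :
  quat_norm (quat_conj u) = quat_norm u.
Proof. by case: u => a b c d /=; rewrite !sqrrN. Qed.

(** Euler's four-square identity under the square root. *)
Lemma quat_normM (R : realType) (x y : quat R) :
  quat_norm (x * y) = quat_norm x * quat_norm y.
Proof.
case: x y => [a b c d] [a' b' c' d']; rewrite quat_mulE /= -sqrtrM.
  by congr Num.sqrt; ring.
by rewrite !addr_ge0 ?sqr_ge0.
Qed.

Lemma quat_mulV (R : realType) (u : quat R) :
  quat_norm u = 1 -> u * quat_conj u = 1.
Proof.
case: u => a b c d /= h.
have h2 : a ^+ 2 + b ^+ 2 + c ^+ 2 + d ^+ 2 = 1.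
  rewrite -[LHS]sqr_sqrtr ?h ?expr1n //.
  by rewrite !addr_ge0 ?sqr_ge0.
by rewrite quat_mulE /=; congr Quat; [rewrite -[RHS]h2|..]; ring.
Qed.

Lemma quat_mulVl (R : realType) (u : quat R) :
  quat_norm u = 1 -> quat_conj u * u = 1.
Proof.
by move=> h; rewrite -{2}[u]quat_conjK quat_mulV ?quat_norm_conj.
Qed.

(** The commutator of two quaternions is twice the cross product of their imaginary parts, so it
    vanishes only if that cross product does. *)
Lemma quat_comm_imag (R : realType) (a b c d a' b' c' d' : R) :
  Quat a b c d * Quat a' b' c' d' = Quat a' b' c' d' * Quat a b c d ->
  b * c' = c * b' /\ c * d' = d * c' /\ d * b' = b * d'.
Proof.
rewrite !quat_mulE /=; case=> *.
by repeat split; lra.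
Qed.

(** Multiply the equation by [quat_conj v] on the left and by [u] on the right. *)
Lemma conj_eq_comm (R : realType) (u v q : quat R) :
  quat_norm u = 1 -> quat_norm v = 1 ->
  u * q * quat_conj u = v * q * quat_conj v ->
  quat_conj v * u * q = q * (quat_conj v * u).
Proof.
move=> hu hv h.
have: quat_conj v * (u * q * quat_conj u) * u
      = quat_conj v * (v * q * quat_conj v) * u by rewrite h.
rewrite !mulrA (quat_mulVl hv) mul1r -[X in X = _]mulrA (quat_mulVl hu) mulr1.
by rewrite -!mulrA.
Qed.

Lemma nonreal_conj_injective (R : realType) (q : quat R) :
  ~ quat_real q ->
  exists u : R -> quat R, (forall t, quat_norm (u t) = 1) /\
    injective (fun t => u t * q * quat_conj (u t)).
Proof.
case: q => a b c d hq.
(* The normalizing factor of [1 + t e]: [u_t] is [r t + r t * t e]. *)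
pose r (t : R) := (Num.sqrt (1 + t ^+ 2))^-1.
have p_gt0 t : 0 < 1 + t ^+ 2 :> R by rewrite ltr_pwDl ?ltr01 ?sqr_ge0.
have r_gt0 t : 0 < r t by rewrite invr_gt0 sqrtr_gt0.
have r2 t : r t ^+ 2 + (r t * t) ^+ 2 = 1.
  by rewrite exprMn -[X in X + _]mulr1 -mulrDr exprVn sqr_sqrtr ?ltW // mulVf ?gt_eqF.
(* The bracket is the [e]-coordinate of [u_s^* u_t]; [z] will be a coordinate of [q] along an
   imaginary unit other than [e]. *)
have inj s t z : (r s * (r t * t) - r s * s * r t) * z = 0 -> z != 0 -> s = t.
  move=> /eqP h /negPf z0; move: h; rewrite mulf_eq0 z0 orbF.
  rewrite (_ : _ - _ = r s * r t * (t - s)); last by ring.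
  by rewrite mulf_eq0 subr_eq0 mulf_eq0 !(gt_eqF (r_gt0 _)) => /eqP.
(* If [c = d = 0], then [q] commutes with [i] but, as [b] is nonzero, not with [j]: take [e = j].
   Otherwise [e = i] works. *)
have [cd0|cd0] := boolP ((c == 0) && (d == 0)).
  case/andP: cd0 => /eqP c0 /eqP d0; subst c d.
  have b0 : b != 0 by apply/eqP => b0; apply: hq; exists a; rewrite b0.
  exists (fun t => Quat (r t) 0 (r t * t) 0).
  have hu t : quat_norm (Quat (r t) 0 (r t * t) 0) = 1.
    by rewrite /= expr0n /= !addr0 r2 sqrtr1.
  split=> // s t /(conj_eq_comm (hu s) (hu t)).
  rewrite [quat_conj _ * _]quat_mulE /= => /quat_comm_imag [h _].
  by apply/esym/(inj _ _ b) => //; rewrite mulr0 in h; rewrite [RHS]h; ring.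
exists (fun t => Quat (r t) (r t * t) 0 0).
have hu t : quat_norm (Quat (r t) (r t * t) 0 0) = 1.
  by rewrite /= expr0n /= !addr0 r2 sqrtr1.
split=> // s t /(conj_eq_comm (hu s) (hu t)).
rewrite [quat_conj _ * _]quat_mulE /= => /quat_comm_imag [h1 [_ h2]].
(* For [e = i] the cross product gives one equation with factor [c] and one with factor [d]; the
   nonzero factor decides which is used. *)
apply/esym; case/nandP: cd0 => z0; apply: (inj _ _ _ _ z0); lra.
Qed.

Definition conjmx (R : realType) (n : nat) (u : quat R) (G : 'M[quat R]_n) :
    'M[quat R]_n :=
  \matrix_(i, j) (u * G i j * quat_conj u).

(** Conjugation by a unit [u] is a ring automorphism that preserves norms, commutes with [quat_conj]
    and fixes the real number [n]. *)
Lemma conjmx_qhm (R : realType) (n : nat) (u : quat R) (G : 'M[quat R]_n) :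
  quat_norm u = 1 -> is_qhm G -> is_qhm (conjmx u G).
Proof.
move=> hu [hN hG]; split=> [i j|].
  by rewrite mxE !quat_normM quat_norm_conj hu hN !mulr1.
apply/matrixP => i j; move/matrixP/(_ i j): hG; rewrite !mxE => hG.
transitivity (u * (\sum_k G i k * adjmx G k j) * quat_conj u).
  rewrite mulr_sumr mulr_suml; apply: eq_bigr => k _.
  rewrite !mxE !quat_conjM quat_conjK !mulrA; congr (_ * _ * _).
  by rewrite -[X in X = _]mulrA (quat_mulVl hu) mulr1.
rewrite hG; case: (i == j); last by rewrite !mulr0n mulr0 mul0r.
by rewrite !mulr1n mulr_natr mulrnAl quat_mulV.
Qed.

Lemma conjmx_normalized (R : realType) (n : nat) (u : quat R)
    (G : 'M[quat R]_n) :
  quat_norm u = 1 -> normalized G -> normalized (conjmx u G).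
Proof. by move=> hu hG i j h; rewrite mxE hG // mulr1 quat_mulV. Qed.

(** Induction on [s], one row operation per index; [uniq s] ensures that no row is multiplied
    twice. *)
Lemma qhm_equiv_rows (R : realType) (n : nat) (u : quat R)
    (G H : 'M[quat R]_n) (s : seq 'I_n) :
  quat_norm u = 1 -> uniq s -> qhm_equiv G H ->
  qhm_equiv G (\matrix_(i, j) (if i \in s then u * H i j else H i j)).
Proof.
move=> hu + hGH; elim: s => [_|k s IH /= /andP[ks us]].
  by rewrite (_ : \matrix_(i, j) _ = H) //; apply/matrixP => i j; rewrite mxE.
have := qhm_equiv_row k hu (IH us); congr qhm_equiv.
apply/matrixP => i j; rewrite !mxE in_cons.
by case: eqP => [->|]; rewrite ?(negPf ks).
Qed.

Lemma qhm_equiv_cols (R : realType) (n : nat) (u : quat R)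
    (G H : 'M[quat R]_n) (s : seq 'I_n) :
  quat_norm u = 1 -> uniq s -> qhm_equiv G H ->
  qhm_equiv G (\matrix_(i, j) (if j \in s then H i j * u else H i j)).
Proof.
move=> hu + hGH; elim: s => [_|k s IH /= /andP[ks us]].
  by rewrite (_ : \matrix_(i, j) _ = H) //; apply/matrixP => i j; rewrite mxE.
have := qhm_equiv_col k hu (IH us); congr qhm_equiv.
apply/matrixP => i j; rewrite !mxE in_cons.
by case: eqP => [->|]; rewrite ?(negPf ks).
Qed.

(** Multiply every row by [u] on the left, then every column by [quat_conj u] on the right. *)
Lemma conjmx_equiv (R : realType) (n : nat) (u : quat R) (G : 'M[quat R]_n) :
  quat_norm u = 1 -> qhm_equiv G (conjmx u G).
Proof.
move=> hu; have hv : quat_norm (quat_conj u) = 1 by rewrite quat_norm_conj.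
have := qhm_equiv_cols hv (enum_uniq 'I_n)
  (qhm_equiv_rows hu (enum_uniq 'I_n) (qhm_equiv_refl G)).
by congr qhm_equiv; apply/matrixP => i j; rewrite !mxE !mem_enum.
Qed.

(** A countable set is Lebesgue null, whereas the unit interval has measure 1. *)
Lemma realType_uncountable (R : realType) : ~ countable [set: R].
Proof.
move=> /countable_lebesgue_measure0 h.
have : (lebesgue_measure (`[0%R, 1%R] : set R) <= lebesgue_measure [set: R])%E.
  by apply: le_measure; rewrite ?inE.
by rewrite h lebesgue_measure_itv /= lte_fin ltr01 oppr0 adde0 lee_fin ler10.
Qed.

Theorem proposition17 (R : realType) (n : nat) (G : 'M[quat R]_n)
    (hG : is_qhm G) (hnorm : normalized G)
    (hnonreal : exists i j : 'I_n, ~ quat_real (G i j)) :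
  ~ countable [set H : 'M[quat R]_n | is_qhm H /\ normalized H /\ qhm_equiv G H].
Proof.
have [i [j /nonreal_conj_injective [u [hu u_inj]]]] := hnonreal.
move=> hcount; apply: (@realType_uncountable R); apply: sub_countable hcount.
(* The non-real entry at [(i, j)] alone separates the conjugated matrices. *)
have f_inj : injective (fun t => conjmx (u t) G).
  by move=> s t /matrixP/(_ i j); rewrite !mxE => /u_inj.
(* Replace the reals by their equipotent image under this injection; it remains to see that the
   image lies in the set in question. *)
rewrite -(card_le_eql (inj_card_eq (in2W f_inj))).
apply: subset_card_le => _ [t _ <-]; split; first exact: conjmx_qhm.
by split; [exact: conjmx_normalized|exact: conjmx_equiv].
Qed.
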